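(* Let $\mathfrak{g}$ be a finite-dimensional Lie algebra over a field $\mathbb{K}$ of characteristic zero. Let $V$ and $W$ be two non-negative dg $\mathfrak{g}$-modules, and assume that $V$ and $W$ are dg lifts of $\mathfrak{g}$-modules $E$ and $F$, respectively. If $V$ is a resolution of $E$, then for every $\mathfrak{g}$-module morphism $\varphi\colon E\to F$ there exists a weak morphism $f\colon V\rightsquigarrow W$ of dg $\mathfrak{g}$-modules which is a dg lift of $\varphi$. Moreover, any two dg lifts of $\varphi$ are homotopic, i.e. the homotopy class $[f]$ is unique.
   Context: A dg $\mathfrak{g}$-module is a bounded cochain complex $(V^\bullet,d^V)$ in which each $V^i$ is a $\mathfrak{g}$-module and each differential is $\mathfrak{g}$-equivariant; it is non-negative if $V^i=0$ for $i<0$. Write $\Omega_{\mathfrak g}=\wedge^\bullet\mathfrak g^\vee$ and $\Omega_{\mathfrak g}(V)=\wedge^\bullet\mathfrak g^\vee\otimes V$, graded so that $\wedge^p\mathfrak g^\vee\otimes V^q$ has degree $p+q$, with total differential $d^V_{\mathrm{tot}}=d^V_{\mathrm{CE}}+d^V$, where $d^V_{\mathrm{CE}}$ is the Chevalley–Eilenberg differential of the $\mathfrak g$-module $\oplus_iV^i$ and $d^V(\omega\otimes v)=(-1)^p\omega\otimes d^Vv$ for $\omega\in\wedge^p\mathfrak g^\vee$. A weak morphism $f\colon V\rightsquigarrow W$ is a degree $0$, $\Omega_{\mathfrak g}$-linear map $f\colon\Omega_{\mathfrak g}(V)\to\Omega_{\mathfrak g}(W)$ with $f\circ d^V_{\mathrm{tot}}=d^W_{\mathrm{tot}}\circ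 f$; it is determined by components $f_k^l\colon V^k\to\wedge^l\mathfrak g^\vee\otimes W^{k-l}$. Two weak morphisms $f,f'\colon V\rightsquigarrow W$ are homotopic if there is a degree $-1$, $\Omega_{\mathfrak g}$-linear map $h\colon\Omega_{\mathfrak g}(V)\to\Omega_{\mathfrak g}(W)$ with $f'-f=d^W_{\mathrm{tot}}\circ h+h\circ d^V_{\mathrm{tot}}$. The $\mathfrak g$-module $\mathbf H^0(V)=\ker d^V_0/\mathrm{im}\,d^V_{-1}$, and for a weak morphism $f$, $\mathbf H^0(f)\colon\mathbf H^0(V)\to\mathbf H^0(W)$ is the $\mathfrak g$-module map induced by $f_0^0$. A dg $\mathfrak g$-module $V$ is a dg lift of a $\mathfrak g$-module $E$ if $V$ is non-negative and $E\cong\mathbf H^0(V)=\ker d^V_0$ as $\mathfrak g$-modules; it is a resolution of $E$ if moreover $\mathbf H^i(V)=0$ for all $i\ge1$. If $V,W$ are dg lifts of $E,F$ and $\varphi\colon E\to F$ is a $\mathfrak g$-module map, a dg lift of $\varphi$ is a weak morphism $f\colon V\rightsquigarrow W$ with $\mathbf H^0(f)=\varphi$ (under the identifications $E\cong\mathbf H^0(V)$, $F\cong\mathbf H^0(W)$). *)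

(* Defs.v *)
From HB Require Import structures.
From mathcomp Require Import all_boot all_order all_algebra.
Set Implicit Arguments. Unset Strict Implicit. Unset Printing Implicit Defensive.
Import Order.TTheory GRing.Theory Num.Theory.
Local Open Scope ring_scope.

(* A finite-dimensional Lie algebra g over K, given by its structure constants
   w.r.t. a basis e_0,...,e_{n-1}: [e_i, e_j] = \sum_k lie_c i j k e_k.        *)
Record lieAlg (K : fieldType) (n : nat) := LieAlg {
  lie_c : 'I_n -> 'I_n -> 'I_n -> K;
  lie_alt : forall i k, lie_c i i k = 0;
  lie_antisym : forall i j k, lie_c i j k = - lie_c j i k;
  lie_jacobi : forall i j k m,
    \sum_(l < n) (lie_c j k l * lie_c i l m + lie_c k i l * lie_c j l m
                  + lie_c i j l * lie_c k l m) = 0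
}.

Definition lin_map (K : fieldType) (M N : lmodType K) (f : M -> N) :=
  forall (a : K) (x y : M), f (a *: x + y) = a *: f x + f y.

Record gmod (K : fieldType) (n : nat) (g : lieAlg K n) := GMod {
  gm_car :> lmodType K;
  gm_act : 'I_n -> gm_car -> gm_car;
  gm_act_lin : forall i, lin_map (gm_act i);
  gm_bracket : forall i j v,
    gm_act i (gm_act j v) - gm_act j (gm_act i v)
      = \sum_(k < n) lie_c g i j k *: gm_act k v
}.
Arguments gm_act {K n g} _ _ _.

Definition gmod_mor (K : fieldType) (n : nat) (g : lieAlg K n)
    (E F : gmod g) (phi : E -> F) :=
  lin_map phi /\ forall i e, phi (gm_act E i e) = gm_act F i (phi e).

(* A bounded dg g-module, presented as its total space (+)_i V^i together with
   the projections pi_i onto the summands V^i (i : int), the differential d,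
   and the g-action on the total space (preserving each V^i).               *)
Record dgmod (K : fieldType) (n : nat) (g : lieAlg K n) := DGMod {
  dg_car :> lmodType K;
  dg_act : 'I_n -> dg_car -> dg_car;
  dg_act_lin : forall i, lin_map (dg_act i);
  dg_bracket : forall i j v,
    dg_act i (dg_act j v) - dg_act j (dg_act i v)
      = \sum_(k < n) lie_c g i j k *: dg_act k v;
  dg_pi : int -> dg_car -> dg_car;
  dg_pi_lin : forall i, lin_map (dg_pi i);
  dg_pi_orth : forall i j v, dg_pi i (dg_pi j v) = if i == j then dg_pi i v else 0;
  dg_bounded : exists N : nat,
    (forall i : int, (N < `|i|)%N -> forall v, dg_pi i v = 0) /\
    (forall v, v = \sum_(k < (N + N).+1) dg_pi (k%:Z - N%:Z) v);
  dg_act_pi : forall i k v, dg_act i (dg_pi k v) = dg_pi k (dg_act i v);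
  dg_d : dg_car -> dg_car;
  dg_d_lin : lin_map dg_d;
  dg_d_pi : forall k v, dg_d (dg_pi k v) = dg_pi (k + 1) (dg_d v);
  dg_dd : forall v, dg_d (dg_d v) = 0;
  dg_d_act : forall i v, dg_d (dg_act i v) = dg_act i (dg_d v)
}.
Arguments dg_act {K n g} _ _ _.
Arguments dg_pi {K n g} _ _ _.
Arguments dg_d {K n g} _ _.

Notation Om n M := {ffun {set 'I_n} -> M}.

Section Omega.
Variables (K : fieldType) (n : nat) (g : lieAlg K n).

(* Omega_g(M) = wedge^* g^v (x) M: an element is recorded by its coefficients
   omega S in M of the basis monomials e^S = e^{s_1} /\ ... /\ e^{s_p}
   (S = {s_1 < ... < s_p}), i.e. omega S = omega(e_{s_1}, ..., e_{s_p}).    *)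


Definition idx (S : {set 'I_n}) (a : 'I_n) : nat := #|[set t in S | (t < a)%N]|.

(* left multiplication by the generator e^i of Omega_g *)
Definition eps (M : lmodType K) (i : 'I_n) (w : Om n M) : Om n M :=
  [ffun S : {set 'I_n} => if i \in S then (-1) ^+ idx S i *: w (S :\ i) else 0].

(* omega(e_k, e_T) for T increasing *)
Definition evalk (M : lmodType K) (w : Om n M) (k : 'I_n) (T : {set 'I_n}) : M :=
  if k \in T then 0 else (-1) ^+ idx T k *: w (k |: T).

Variable V : dgmod g.

Definition dCE (w : Om n V) : Om n V :=
  [ffun S : {set 'I_n} =>
     \sum_(a in S) (-1) ^+ idx S a *: dg_act V a (w (S :\ a))
   + \sum_(a in S) \sum_(b in S | (a < b)%N)
        (-1) ^+ (idx S a + idx S b) *: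
          \sum_(k < n) lie_c g a b k *: evalk w k (S :\ a :\ b)].

(* internal differential: d(omega (x) v) = (-1)^p omega (x) d v *)
Definition dInt (w : Om n V) : Om n V :=
  [ffun S : {set 'I_n} => (-1) ^+ #|S| *: dg_d V (w S)].

Definition dtot (w : Om n V) : Om n V := dCE w + dInt w.

(* projection onto total degree N (wedge^p g^v (x) V^q with p + q = N) *)
Definition Pdeg (N : int) (w : Om n V) : Om n V :=
  [ffun S : {set 'I_n} => dg_pi V (N - (#|S|)%:Z) (w S)].

Definition emb0 (v : V) : Om n V := [ffun S : {set 'I_n} => if S == set0 then v else 0].

End Omega.

Section Morphisms.
Variables (K : fieldType) (n : nat) (g : lieAlg K n).

(* weak morphism V ~> W: degree 0, Omega_g-linear (K-linear and commuting with
   left multiplication by the generators e^i), commuting with d_tot *)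
Definition weak_mor (V W : dgmod g) (f : Om n V -> Om n W) :=
  [/\ lin_map f,
      forall N w, f (Pdeg N w) = Pdeg N (f w),
      forall i w, f (eps i w) = eps i (f w) &
      forall w, f (dtot w) = dtot (f w)].

(* homotopy: degree -1, Omega_g-linear in the graded (Koszul) sense *)
Definition homotopic (V W : dgmod g) (f f' : Om n V -> Om n W) :=
  exists h : Om n V -> Om n W,
  [/\ lin_map h,
      forall N w, h (Pdeg N w) = Pdeg (N - 1) (h w),
      forall i w, h (eps i w) = - eps i (h w) &
      forall w, f' w - f w = dtot (h w) + h (dtot w)].

Definition nonneg (V : dgmod g) := forall i : int, i < 0 -> forall v, dg_pi V i v = 0.

(* V is a dg lift of E via the identification alpha : E ~= H^0(V) = ker d_0 *)
Definition dg_lift (V : dgmod g) (E : gmod g) (alpha : E -> V) :=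
  nonneg V /\
  [/\ lin_map alpha,
      forall i e, alpha (gm_act E i e) = dg_act V i (alpha e),
      injective alpha,
      forall e, dg_pi V 0 (alpha e) = alpha e /\ dg_d V (alpha e) = 0 &
      forall v, dg_pi V 0 v = v -> dg_d V v = 0 -> exists e, alpha e = v].

Definition resolution (V : dgmod g) (E : gmod g) (alpha : E -> V) :=
  dg_lift alpha /\
  forall i : int, 0 < i -> forall v, dg_pi V i v = v -> dg_d V v = 0 ->
    exists u, dg_pi V (i - 1) u = u /\ dg_d V u = v.

(* f is a dg lift of phi: H^0(f) = phi under the identifications *)
Definition dg_lift_mor (V W : dgmod g) (E F : gmod g)
    (alpha : E -> V) (beta : F -> W) (phi : E -> F) (f : Om n V -> Om n W) :=
  weak_mor f /\ forall e, f (emb0 (alpha e)) set0 = beta (phi e).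

End Morphisms.

(* Main.v *)
Require Import Defs.
From HB Require Import structures.
From mathcomp Require Import boolp classical_sets.
From mathcomp Require Import all_boot all_order all_algebra.
Set Implicit Arguments. Unset Strict Implicit. Unset Printing Implicit Defensive.
Import Order.TTheory GRing.Theory Num.Theory.
Local Open Scope ring_scope.

(** Since [K] is a field, the exact complex [0 -> E -> V^0 -> V^1 -> ...] splits
    linearly: there are a linear map [s] of degree [-1] on [V] and a linear
    retraction [p] of [alpha] with [d s + s d = 1 - alpha p].  Extended to
    [Omega_g(V)], [s] satisfies [dtot s + s dtot = 1 - alpha p - N], where
    [N = - \sum_a e^a [rho_a, s]] raises the form degree, hence is nilpotent, and
    vanishes on [Omega_g (x) alpha(E)].  If [Th : Omega_g(V) -> Omega_g(W)] is
    [Omega_g]-linear, [dtot]-closed and vanishes on [Omega_g (x) alpha(E)], then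
    [h = \sum_j Th N^j s] is a null-homotopy of [Th].  Uniqueness is the case
    [Th = f' - f].  For existence, [f0 = beta phi p] is a chain map up to the
    closed odd map [Th = dtot f0 - f0 dtot], and [f = f0 + h].

    The identity [dtot^2 = 0] comes from Cartan's formula [d i_k + i_k d = L_k]:
    an operator that commutes up to a scalar with all contractions and has no
    component of form degree [0] is zero. *)

(** * The exterior algebra *)

Section Exterior.
Variables (K : fieldType) (n : nat).
Implicit Types (M N : lmodType K) (i j k a b : 'I_n) (S T : {set 'I_n}).

Lemma idx_setU1 S a b : a \notin S -> idx (a |: S) b = ((a < b) + idx S b)%N.
Proof.
move=> aS; rewrite /idx; case: ltnP => ab.
  rewrite (_ : [set t in _ | _] = a |: [set t in S | (t < b)%N]).
    by rewrite cardsU1 inE (negPf aS).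
  by apply/setP => t; rewrite !inE; case: eqP => // ->; rewrite ab.
rewrite add0n; apply: eq_card => t; rewrite !inE; case: eqP => //= ->.
by rewrite ltnNge ab andbF.
Qed.

Lemma idx_setD1 S a b : a \in S -> idx S b = ((a < b) + idx (S :\ a) b)%N.
Proof. by move=> aS; rewrite -idx_setU1 ?setD1K // !inE eqxx. Qed.

Lemma scale_sign_odd M (p q : nat) (x : M) :
  odd p = odd q -> (-1) ^+ p *: x = (-1) ^+ q *: x.
Proof. by move=> e; rewrite -signr_odd e signr_odd. Qed.

Lemma scale_sign_oddN M (p q : nat) (x : M) :
  odd p = ~~ odd q -> (-1) ^+ p *: x = - ((-1) ^+ q *: x).
Proof. by move=> e; rewrite -scaleNr -(mulN1r (_ ^+ _)) -exprS; apply: scale_sign_odd. Qed.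

Lemma odd_ltn_neq i j : i != j -> (j < i)%N = ~~ (i < j)%N.
Proof. by rewrite -(inj_eq val_inj) /=; case: ltngtP. Qed.

Fact eps_is_linear M i : linear (@eps K n M i).
Proof.
move=> c u v; apply/ffunP => S; rewrite !ffunE; case: ifP => _; last first.
  by rewrite scaler0 addr0.
by rewrite scalerDr !scalerA mulrC.
Qed.
HB.instance Definition _ M i :=
  GRing.isLinear.Build K (Om n M) (Om n M) _ (@eps K n M i) (@eps_is_linear M i).

(** This is the interior product $i_k$ by the basis vector $e_k$. *)
Definition contr M k (w : Om n M) : Om n M := [ffun T => evalk w k T].

Fact contr_is_linear M k : linear (@contr M k).
Proof.
move=> c u v; apply/ffunP => S; rewrite !ffunE /evalk; case: ifP => _.
  by rewrite scaler0 addr0.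
by rewrite !ffunE scalerDr !scalerA mulrC.
Qed.
HB.instance Definition _ M k :=
  GRing.isLinear.Build K (Om n M) (Om n M) _ (@contr M k) (@contr_is_linear M k).

(** For $i \neq j$ exactly one of $i<j$ and $j<i$ holds, so the two orders of removal give sign
    exponents of opposite parity. *)
Lemma eps_eps M i j (w : Om n M) : eps i (eps j w) = - eps j (eps i w).
Proof.
apply/ffunP => S; rewrite !ffunE !inE.
case: (eqVneq i j) => [->|ij]; first by rewrite /=; case: ifP; rewrite ?scaler0 oppr0.
rewrite /=; case: ifP => iS; last first.
  by case: ifP => _; rewrite ?scaler0 oppr0.
case: ifP => jS; last by rewrite scaler0 oppr0.
rewrite !scalerA -!exprD (_ : S :\ j :\ i = S :\ i :\ j); last first.
  by rewrite setDDl setUC -setDDl.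
apply: scale_sign_oddN; rewrite (idx_setD1 j iS) (idx_setD1 i jS) !oddD.
by rewrite (odd_ltn_neq ij) !oddb; move: (odd _) (odd _) (_ < _)%N => [] [] [].
Qed.

Lemma contr_contr M i j (w : Om n M) : contr i (contr j w) = - contr j (contr i w).
Proof.
apply/ffunP => S; rewrite !ffunE /evalk !ffunE /evalk !inE.
case: (eqVneq i j) => [->|ij]; first by rewrite /=; case: ifP; rewrite ?scaler0 oppr0.
rewrite /=; case: ifP => iS.
  by case: ifP => _; rewrite ?scaler0 oppr0.
case: ifP => jS; first by rewrite scaler0 oppr0.
rewrite !scalerA -!exprD setUCA.
apply: scale_sign_oddN; rewrite !idx_setU1 ?iS ?jS // !oddD.
by rewrite (odd_ltn_neq ij) !oddb; move: (odd _) (odd _) (_ < _)%N => [] [] [].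
Qed.

(** This Clifford relation, with the two anticommutation rules above, lets Cartan's formula be
    proved without counting signs on subsets. *)
Lemma contr_eps M i j (w : Om n M) :
  contr i (eps j w) = (if i == j then w else 0) - eps j (contr i w).
Proof.
apply/eqP; rewrite -subr_eq opprK; apply/eqP.
apply/ffunP => S; rewrite !ffunE /evalk !ffunE /evalk !inE.
case: (eqVneq i j) => [<-|ij].
  rewrite /=; case: ifP => iS.
    rewrite add0r !scalerA -exprD setD1K //.
    by rewrite (idx_setD1 i iS) ltnn addnn -signr_odd odd_double scale1r.
  rewrite addr0 scalerA -exprD setU1K ?iS //.
  by rewrite idx_setU1 ?iS // ltnn addnn -signr_odd odd_double scale1r.
rewrite ffunE /=.
case: ifP => iS; first by case: ifP => _; rewrite ?scaler0 addr0.
case: ifP => jS; last by rewrite scaler0 addr0.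
rewrite !scalerA -!exprD (_ : (i |: S) :\ j = i |: S :\ j); last first.
  by rewrite setDUl; congr (_ :|: _); apply/setDidPl; rewrite disjoints1 inE.
apply/eqP; rewrite addr_eq0; apply/eqP.
apply: scale_sign_oddN; rewrite (idx_setD1 i jS) !idx_setU1 ?iS ?jS // !oddD.
by rewrite (odd_ltn_neq ij) !oddb; move: (odd _) (odd _) (_ < _)%N => [] [] [].
Qed.

Lemma eps_set0 M i (w : Om n M) : eps i w set0 = 0.
Proof. by rewrite ffunE inE. Qed.

(* The coefficient of e^S is, up to sign, the iterated contraction along S
   evaluated at the empty set. *)
Lemma contr_local M (X : Om n M -> Om n M) (c : K) :
  (forall w, X w set0 = 0) -> (forall k w, contr k (X w) = c *: X (contr k w)) ->
  forall w, X w = 0.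
Proof.
move=> X0 Xi w; apply/ffunP => S; rewrite ffunE.
have [m] := ubnP #|S|; elim: m => // m IH in S w *.
case: (set_0Vmem S) => [->|[k kS]]; first by rewrite X0.
rewrite ltnS (cardsD1 k) kS add1n => lt_m.
have: contr k (X w) (S :\ k) = 0 by rewrite Xi ffunE IH // scaler0.
rewrite ffunE /evalk !inE eqxx /= setD1K // => /eqP.
by rewrite scaler_eq0 signr_eq0 => /eqP.
Qed.

(* Omega_g(M) is generated over Omega_g by its form-degree-0 part M. *)
Lemma eps_local M N (X : {linear Om n M -> N}) (Q : M -> Prop) :
  (forall v, Q v -> X [ffun S => if S == set0 then v else 0] = 0) ->
  (forall k w, X w = 0 -> X (eps k w) = 0) ->
  forall w : Om n M, (forall S, Q (w S)) -> X w = 0.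
Proof.
move=> X0 Xe w Qw.
pose sg S v : Om n M := [ffun T => if T == S then v else 0].
have sgP S v : Q v -> X (sg S v) = 0.
  move=> Qv; have [m] := ubnP #|S|; elim: m => // m IH in S *.
  case: (set_0Vmem S) => [->|[k kS]]; first by move=> _; exact: X0.
  rewrite ltnS (cardsD1 k) kS add1n => lt_m.
  (* Up to this sign, the monomial $e^S \otimes v$ is [eps k] applied to the monomial on $S
     \setminus \{k\}$. *)
  suff: X ((-1) ^+ idx S k *: sg S v) = 0.
    rewrite -signr_odd; case: odd; last by rewrite scale1r.
    by rewrite expr1 scaleN1r linearN => /eqP; rewrite oppr_eq0 => /eqP.
  rewrite (_ : _ *: _ = eps k (sg (S :\ k) v)); first exact/Xe/IH.
  apply/ffunP => T; rewrite !ffunE; case: (eqVneq T S) => [->|TS].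
    by rewrite kS eqxx.
  rewrite scaler0; case: ifP => // kT; rewrite ifN ?scaler0 //.
  by apply: contra_neq TS => e; rewrite -(setD1K kT) e setD1K.
rewrite (_ : w = \sum_S sg S (w S)).
  by rewrite linear_sum big1 // => S _; exact: sgP.
apply/ffunP => T; rewrite sum_ffunE (bigD1 T) //= big1 ?addr0 => [|S TS].
  by rewrite ffunE eqxx.
by rewrite ffunE eq_sym (negPf TS).
Qed.

(** * Extension of coefficient maps to forms *)

Definition pt M N (h : M -> N) (w : Om n M) : Om n N := [ffun S => h (w S)].
(** The factor $(-1)^p$ is the Koszul sign of an odd map [h] passing a $p$-form; [pt] is the
    extension without sign, for even maps. *)
Definition tw M N (h : M -> N) (w : Om n M) : Om n N :=
  [ffun S : {set 'I_n} => (-1) ^+ #|S| *: h (w S)].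

Fact pt_is_linear M N (h : {linear M -> N}) : linear (pt h).
Proof. by move=> c u v; apply/ffunP => S; rewrite !ffunE linearP. Qed.
HB.instance Definition _ M N (h : {linear M -> N}) :=
  GRing.isLinear.Build K (Om n M) (Om n N) _ (pt h) (pt_is_linear h).

Fact tw_is_linear M N (h : {linear M -> N}) : linear (tw h).
Proof.
move=> c u v; apply/ffunP => S.
by rewrite !ffunE linearP scalerDr !scalerA mulrC.
Qed.
HB.instance Definition _ M N (h : {linear M -> N}) :=
  GRing.isLinear.Build K (Om n M) (Om n N) _ (tw h) (tw_is_linear h).

Lemma pt_eps M N (h : {linear M -> N}) i w : pt h (eps i w) = eps i (pt h w).
Proof. by apply/ffunP => S; rewrite !ffunE; case: ifP; rewrite ?linearZ ?linear0. Qed.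

Lemma pt_contr M N (h : {linear M -> N}) i w : pt h (contr i w) = contr i (pt h w).
Proof.
by apply/ffunP => S; rewrite !ffunE /evalk !ffunE; case: ifP; rewrite ?linearZ ?linear0.
Qed.

Lemma tw_eps M N (h : {linear M -> N}) i w : tw h (eps i w) = - eps i (tw h w).
Proof.
apply/ffunP => S; rewrite !ffunE; case: ifP => iS; last by rewrite linear0 scaler0 oppr0.
rewrite linearZ /= !scalerA -!exprD; apply: scale_sign_oddN.
by rewrite (cardsD1 i) iS !oddD /=; do 2 case: (odd _).
Qed.

Lemma tw_contr M N (h : {linear M -> N}) i w : tw h (contr i w) = - contr i (tw h w).
Proof.
apply/ffunP => S; rewrite !ffunE /evalk !ffunE; case: ifP => iS.
  by rewrite linear0 scaler0 oppr0.
rewrite linearZ /= !scalerA -!exprD; apply: scale_sign_oddN.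
by rewrite cardsU1 iS !oddD /=; do 2 case: (odd _).
Qed.
End Exterior.

(** * The Chevalley-Eilenberg differential *)

Section ChevalleyEilenberg.
Variables (K : fieldType) (n : nat) (g : lieAlg K n).
Local Notation c := (lie_c g).
Implicit Types (V W : dgmod g) (i j k a b : 'I_n).

HB.instance Definition _ V i :=
  GRing.isLinear.Build K V V _ (@dg_act K n g V i) (@dg_act_lin K n g V i).
HB.instance Definition _ V (m : int) :=
  GRing.isLinear.Build K V V _ (@dg_pi K n g V m) (@dg_pi_lin K n g V m).
HB.instance Definition _ V :=
  GRing.isLinear.Build K V V _ (@dg_d K n g V) (@dg_d_lin K n g V).

(** The commutator $[\rho_i, h]$ measures the failure of [h] to be equivariant. *)
Definition act_comm V W (h : V -> W) i v := dg_act W i (h v) - h (dg_act V i v).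

Fact act_comm_is_linear V W (h : {linear V -> W}) i : linear (act_comm h i).
Proof.
by move=> x u v; rewrite /act_comm !linearP /= addrACA -scalerDr.
Qed.
HB.instance Definition _ V W (h : {linear V -> W}) i :=
  GRing.isLinear.Build K V W _ (act_comm h i) (act_comm_is_linear h i).

(** The differential becomes a polynomial in generators, contractions and the action. The minus sign
    arises because, for $a<b$, removing $a$ from $S$ lowers [idx S b] by one. *)
Lemma dCEE V (w : Om n V) :
  dCE w = \sum_a eps a (pt (dg_act V a) w)
    - \sum_(a : 'I_n) \sum_(b : 'I_n | (a < b)%N) \sum_k
        c a b k *: eps a (eps b (contr k w)).
Proof.
apply/ffunP => S; rewrite !ffunE !sum_ffunE; congr (_ + _).
  by rewrite big_mkcond; apply: eq_bigr => a _; rewrite !ffunE; case: ifP.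
rewrite -sumrN big_mkcond; apply: eq_bigr => a _; rewrite sum_ffunE.
case: ifP => aS; last first.
  rewrite big1 ?oppr0 // => b _; rewrite sum_ffunE big1 // => k _.
  by rewrite !ffunE aS scaler0.
rewrite -sumrN [LHS]big_mkcondl; apply: eq_bigr => b ab; rewrite sum_ffunE.
rewrite scaler_sumr; case: ifP => bS; last first.
  rewrite big1 ?oppr0 // => k _.
  by rewrite !ffunE aS !inE bS andbF !scaler0.
rewrite -sumrN; apply: eq_bigr => k _; rewrite !ffunE aS !inE bS.
rewrite -(inj_eq val_inj) eqn_leq leqNgt ab /= !scalerA.
rewrite (idx_setD1 b aS) ab !exprD expr1 mulN1r mulrN !mulNr -scaleNr.
by rewrite [X in _ = - X *: _]mulrC.
Qed.

Fact dCE_is_linear V : linear (@dCE K n g V).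
Proof.
move=> x u v; rewrite !dCEE scalerBr !scaler_sumr addrACA -opprD -!big_split /=.
congr (_ - _); apply: eq_bigr => a _; first by rewrite !linearP.
rewrite scaler_sumr -big_split; apply: eq_bigr => b _.
rewrite scaler_sumr -big_split; apply: eq_bigr => k _.
by rewrite /= !linearP.
Qed.
HB.instance Definition _ V :=
  GRing.isLinear.Build K (Om n V) (Om n V) _ (@dCE K n g V) (@dCE_is_linear V).

Lemma dInt_tw V (w : Om n V) : dInt w = tw (dg_d V) w.
Proof. by []. Qed.

Fact dtot_is_linear V : linear (@dtot K n g V).
Proof.
by move=> x u v; rewrite /dtot !dInt_tw !linearP scalerDr addrACA.
Qed.
HB.instance Definition _ V :=
  GRing.isLinear.Build K (Om n V) (Om n V) _ (@dtot K n g V) (@dtot_is_linear V).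

(** The terms $e^a e^b i_k$ involve only structure constants and commute with coefficientwise maps,
    so only the equivariance defect of [h] survives. *)
Lemma dCE_pt V W (h : {linear V -> W}) (w : Om n V) :
  dCE (pt h w) - pt h (dCE w) = \sum_a eps a (pt (act_comm h a) w).
Proof.
rewrite !dCEE linearB /= opprD addrACA -opprD -[RHS]subr0; congr (_ - _).
  rewrite linear_sum -sumrB; apply: eq_bigr => a _.
  rewrite /= pt_eps -linearB; congr eps.
  by apply/ffunP => S; rewrite !ffunE.
apply/eqP; rewrite subr_eq0; apply/eqP.
rewrite linear_sum; apply: eq_bigr => a _.
rewrite linear_sum; apply: eq_bigr => b _.
rewrite linear_sum; apply: eq_bigr => k _.
by rewrite linearZ /= !pt_eps pt_contr.
Qed.

(** Each of the three factors of $e^a e^b i_k$ anticommutes with [tw h], so these terms cancel in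
    the anticommutator. *)
Lemma dCE_tw V W (h : {linear V -> W}) (w : Om n V) :
  dCE (tw h w) + tw h (dCE w) = \sum_a eps a (tw (act_comm h a) w).
Proof.
rewrite !dCEE linearB /= addrACA -opprD -[RHS]subr0; congr (_ - _).
  rewrite linear_sum -big_split; apply: eq_bigr => a _.
  rewrite /= tw_eps -linearB; congr eps.
  by apply/ffunP => S; rewrite !ffunE linearZ /= -scalerBr.
rewrite linear_sum -big_split big1 // => a _.
rewrite linear_sum -big_split big1 // => b _.
rewrite linear_sum -big_split big1 // => k _.
rewrite linearZ /= !tw_eps tw_contr [eps b (- _)]linearN /= opprK.
by rewrite scalerN subrr.
Qed.

(** * Lie derivatives and Cartan calculus *)

Definition Lie V k (w : Om n V) : Om n V :=
  pt (dg_act V k) w - \sum_a \sum_b c k a b *: eps a (contr b w).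

Fact Lie_is_linear V k : linear (@Lie V k).
Proof.
move=> x u v; rewrite /Lie linearP scalerBr !scaler_sumr addrACA -opprD -!big_split /=.
congr (_ - _); apply: eq_bigr => a _.
rewrite scaler_sumr -big_split; apply: eq_bigr => b _.
by rewrite /= !linearP.
Qed.
HB.instance Definition _ V k :=
  GRing.isLinear.Build K (Om n V) (Om n V) _ (@Lie V k) (@Lie_is_linear V k).

Lemma sub_ffunE V (u w : Om n V) S : (u - w) S = u S - w S.
Proof. by rewrite !ffunE. Qed.

Lemma Lie_set0 V k (w : Om n V) : Lie k w set0 = dg_act V k (w set0).
Proof.
rewrite !ffunE sum_ffunE big1 ?subr0 // => a _.
by rewrite sum_ffunE big1 // => b _; rewrite ffunE eps_set0 scaler0.
Qed.

Lemma dCE_set0 V (w : Om n V) : dCE w set0 = 0.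
Proof. by rewrite ffunE !big_set0 addr0. Qed.

(** This is $[L_k, i_m] = i_{[e_k,e_m]}$: the contraction $i_m$ meets $e^a$ only for $a=m$. *)
Lemma contr_Lie V m k (w : Om n V) :
  contr m (Lie k w) = Lie k (contr m w) - \sum_b c k m b *: contr b w.
Proof.
rewrite /Lie linearB /= pt_contr -addrA -opprD; congr (_ - _).
rewrite linear_sum (bigD1 m) //= [in RHS](bigD1 m) //= addrAC; congr (_ + _).
  rewrite linear_sum -big_split; apply: eq_bigr => b _ /=.
  by rewrite linearZ /= contr_eps eqxx contr_contr linearN opprK /= scalerDr addrC.
apply: eq_bigr => a am; rewrite linear_sum; apply: eq_bigr => b _.
by rewrite linearZ /= contr_eps eq_sym (negPf am) contr_contr linearN sub0r opprK.
Qed.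

(** Cartan's formula, checked separately on the action terms and on the structure-constant terms. *)
Lemma contr_dCE V m (w : Om n V) : contr m (dCE w) = Lie m w - dCE (contr m w).
Proof.
rewrite !dCEE /Lie linearB /= opprB.
rewrite [RHS](_ : _ = (pt (dg_act V m) w - \sum_a eps a (pt (dg_act V a) (contr m w)))
  - (\sum_a \sum_b c m a b *: eps a (contr b w)
    - \sum_(a : 'I_n) \sum_(b : 'I_n | (a < b)%N) \sum_k
        c a b k *: eps a (eps b (contr k (contr m w))))); last first.
  by rewrite opprB [X in _ + X = _]addrC addrACA [X in _ + X = _]addrC.
congr (_ - _).
  apply/eqP; rewrite eq_sym subr_eq linear_sum -big_split /=; apply/eqP.
  rewrite (bigD1 m) //= contr_eps eqxx -pt_contr addrNK big1 ?addr0 // => a am.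
  by rewrite contr_eps eq_sym (negPf am) pt_contr sub0r addNr.
apply/eqP; rewrite eq_sym subr_eq linear_sum -big_split /=; apply/eqP.
(* Passing $i_m$ through $e^a e^b$ leaves only the terms with $a=m$ or $b=m$. *)
transitivity (\sum_(a : 'I_n) \sum_(b : 'I_n | (a < b)%N) \sum_k c a b k *:
    ((if m == a then eps b (contr k w) else 0)
     - (if m == b then eps a (contr k w) else 0))); last first.
  apply: eq_bigr => a _; rewrite linear_sum -big_split; apply: eq_bigr => b _ /=.
  rewrite linear_sum -big_split; apply: eq_bigr => k _ /=.
  rewrite linearZ -scalerDr /= contr_eps contr_eps [contr m (contr k w)]contr_contr.
  rewrite [eps b (- _)]linearN opprK [eps a (_ + _)]linearD /= opprD addrA addrNK.
  by case: (m == b); rewrite ?linear0.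
pose Z b := \sum_k c m b k *: eps b (contr k w).
(* Antisymmetry of the structure constants brings both kinds of terms to the form [Z]: the indices
   above [m] come from $a=m$, those below from $b=m$, and [Z m] vanishes. *)
transitivity (\sum_(a : 'I_n) \sum_(b : 'I_n | (a < b)%N)
    ((if m == a then Z b else 0) + (if m == b then Z a else 0))); last first.
  apply: eq_bigr => a _; apply: eq_bigr => b ab; rewrite /Z.
  case: eqP => [ma|_]; case: eqP => [mb|_].
  - by move: ab; rewrite -ma -mb ltnn.
  - by rewrite addr0 ma; apply: eq_bigr => k _; rewrite subr0.
  - rewrite add0r -mb; apply: eq_bigr => k _.
    by rewrite sub0r scalerN -scaleNr -lie_antisym.
  - by rewrite addr0 big1 // => k _; rewrite subr0 scaler0.
have e1 : \sum_(a : 'I_n) \sum_(b : 'I_n | (a < b)%N) (if m == a then Z b else 0)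
    = \sum_(b : 'I_n | (m < b)%N) Z b.
  rewrite (bigD1 m) //= [X in _ + X]big1 ?addr0 => [|a am].
    by apply: eq_bigr => b _; rewrite eqxx.
  by rewrite big1 // => b _; rewrite eq_sym (negPf am).
have e2 : \sum_(a : 'I_n) \sum_(b : 'I_n | (a < b)%N) (if m == b then Z a else 0)
    = \sum_(a : 'I_n | (a < m)%N) Z a.
  rewrite [RHS]big_mkcond; apply: eq_bigr => a _; rewrite big_mkcond (bigD1 m) //=.
  by rewrite eqxx big1 ?addr0 // => b bm; rewrite eq_sym (negPf bm) if_same.
have Zm : Z m = 0 by rewrite /Z big1 // => k _; rewrite lie_alt scale0r.
under [RHS]eq_bigr do rewrite big_split /=.
rewrite big_split /= e1 e2 [X in X + _]big_mkcond [X in _ + X]big_mkcond -big_split /=.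
apply: eq_bigr => a _; rewrite -/(Z a).
by case: ltngtP => [_|_|/val_inj <-]; rewrite ?addr0 ?add0r.
Qed.

(** This is the interior product by the bracket $[e_k,e_m]$. *)
Definition contr_br V k m (w : Om n V) : Om n V := \sum_b c k m b *: contr b w.

(** The Jacobi identity in the form $[e_j,[e_k,e_m]] = [e_k,[e_j,e_m]] - [[e_k,e_j],e_m]$. *)
Lemma contr_br_jacobi V k j m (w : Om n V) :
  \sum_b c k m b *: contr_br j b w
    = \sum_b c j m b *: contr_br k b w - \sum_b c k j b *: contr_br b m w.
Proof.
have E (x : 'I_n -> K) (y : 'I_n -> 'I_n -> K) :
    \sum_b x b *: (\sum_r y b r *: contr r w)
    = \sum_r (\sum_b x b * y b r) *: contr r w.
  under eq_bigr do rewrite scaler_sumr.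
  rewrite exchange_big; apply: eq_bigr => r _; rewrite scaler_suml.
  by apply: eq_bigr => b _; rewrite scalerA.
rewrite /contr_br !E -sumrB; apply: eq_bigr => r _; rewrite -scalerBl -sumrB.
congr (_ *: _); apply/eqP; rewrite -subr_eq0 -sumrB -oppr_eq0 -sumrN.
rewrite -[X in _ == X](lie_jacobi g k j m r); apply/eqP/eq_bigr => l _.
rewrite (lie_antisym g k m) (lie_antisym g l m) mulrN mulNr opprK opprB.
by rewrite opprK addrAC.
Qed.

Lemma contr_LieLie V k j m (w : Om n V) :
  contr m (Lie k (Lie j w)) = Lie k (Lie j (contr m w))
    - (Lie k (contr_br j m w) + Lie j (contr_br k m w))
    + \sum_b c k m b *: contr_br j b w.
Proof.
have E (U : zmodType) (x y z t : U) : x - y - (z - t) = x - (y + z) + t.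
  by rewrite opprB opprD !addrA addrAC.
rewrite contr_Lie contr_Lie [Lie k (_ - _)]linearB /= -[RHS]E; congr (_ - _).
rewrite {2}/contr_br linear_sum -sumrB; apply: eq_bigr => b _.
by rewrite contr_Lie scalerBr; congr (_ - _); rewrite linearZ.
Qed.

(** By the Jacobi identity the defect commutes with contractions; in form degree 0 it vanishes by
    the module axiom of [V]. Hence [contr_local] applies. *)
Lemma Lie_comm V k j (w : Om n V) :
  Lie k (Lie j w) - Lie j (Lie k w) = \sum_b c k j b *: Lie b w.
Proof.
apply/eqP; rewrite -subr_eq0; apply/eqP; move: w.
apply: (@contr_local _ _ _ _ 1) => [w|m w].
  rewrite 2!sub_ffunE sum_ffunE !Lie_set0 dg_bracket.
  apply/eqP; rewrite subr_eq0; apply/eqP; apply: eq_bigr => b _.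
  by rewrite ffunE Lie_set0.
have E (U : zmodType) (a b s t q r : U) :
  a - s + (q - r) - (b - s + q) - (t - r) = a - b - t.
  have -> : a - s + (q - r) - (b - s + q) = a - b - r.
    by rewrite opprD addrACA opprB [a - s + _]addrA subrK [q - r - q]addrAC subrr add0r.
  by rewrite opprB addrA subrK.
rewrite scale1r [LHS]linearB /= [contr m (_ - _)]linearB /= 2!contr_LieLie.
have -> : contr m (\sum_b c k j b *: Lie b w)
    = \sum_b c k j b *: Lie b (contr m w) - \sum_b c k j b *: contr_br b m w.
  rewrite linear_sum -sumrB; apply: eq_bigr => b _.
  by rewrite linearZ /= contr_Lie scalerBr.
rewrite contr_br_jacobi [Lie j (contr_br k m w) + _]addrC; exact: E.
Qed.

(** The defect anticommutes with contractions, by Cartan's formula and [Lie_comm], whence the scalar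
    $-1$. *)
Lemma Lie_dCE V k (w : Om n V) : Lie k (dCE w) = dCE (Lie k w).
Proof.
apply/eqP; rewrite -subr_eq0; apply/eqP; move: w.
apply: (@contr_local _ _ _ _ (-1)) => [w|m w].
  by rewrite sub_ffunE Lie_set0 !dCE_set0 linear0 subrr.
rewrite scaleN1r linearB /= contr_Lie !contr_dCE contr_Lie.
rewrite [Lie k (_ - _)]linearB [dCE (_ - _)]linearB /=.
have -> : \sum_b c k m b *: contr b (dCE w)
    = \sum_b c k m b *: Lie b w - dCE (\sum_b c k m b *: contr b w).
  rewrite linear_sum -sumrB; apply: eq_bigr => b _.
  by rewrite contr_dCE scalerBr; congr (_ - _); rewrite linearZ.
rewrite -Lie_comm.
have E (U : zmodType) (a b x y z : U) :
  a - x - (a - b - z) - (b - (y - z)) = - (x - y).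
  have -> : a - x - (a - b - z) = b + z - x.
    by rewrite -[a - b - z]addrA -opprD opprB addrC addrA subrK.
  by rewrite opprB addrC -[y - z - b]addrA -opprD [z + b]addrC addrA subrK opprB.
exact: E.
Qed.

Lemma dCE_dCE V (w : Om n V) : dCE (dCE w) = 0.
Proof.
move: w; apply: (@contr_local _ _ _ _ 1) => [w|m w]; first exact: dCE_set0.
by rewrite scale1r 2!contr_dCE [dCE (_ - _)]linearB /= Lie_dCE opprB addrC subrK.
Qed.

(** The cross terms form the anticommutator of [dCE_tw], which is zero because the internal
    differential is equivariant. *)
Lemma dtot_dtot V (w : Om n V) : dtot (dtot w) = 0.
Proof.
rewrite {1}/dtot dInt_tw {1 2}/dtot !linearD /= dCE_dCE add0r !dInt_tw addrA dCE_tw.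
rewrite big1 ?add0r => [|a _]; last first.
  rewrite (_ : tw _ _ = 0) ?linear0 //; apply/ffunP => S.
  by rewrite !ffunE /act_comm /= dg_d_act subrr scaler0.
apply/ffunP => S; rewrite !ffunE linearZ /= dg_dd.
by rewrite !scaler0.
Qed.
End ChevalleyEilenberg.

(** * Linear splittings *)

Lemma lin_mapW (K : fieldType) (M N : lmodType K) (f : M -> N) :
  lin_map f -> exists h : {linear M -> N}, h =1 f.
Proof.
by move=> fL; exists (HB.pack f (GRing.isLinear.Build K M N _ f fL) : {linear M -> N}).
Qed.

(** Zorn's lemma gives a maximal subspace [A] meeting [B] only in 0; it is a complement of [B], and
    [r] projects along it. *)
Lemma exists_linear_projector (K : fieldType) (M : lmodType K) (B : M -> Prop) :
  B 0 -> (forall t x y, B x -> B y -> B (t *: x + y)) ->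
  exists r : {linear M -> M}, (forall x, B (r x)) /\ (forall x, B x -> r x = x).
Proof.
move=> B0 BL.
pose P (C : set M) := (forall t x y, C x -> C y -> C (t *: x + y)) /\
  (forall x, C x -> B x -> x = 0).
have [|A [[AL AB] Amax]] := @Zorn_bigcup M P.
  move=> F FP Ftot; split=> [t x y [X FX Xx] [Y FY Yy]|x [X FX Xx]].
    have [XY|YX] := Ftot _ _ FX FY.
      by exists Y => //; apply: (FP _ FY).1 => //; exact: XY.
    by exists X => //; apply: (FP _ FX).1 => //; exact: YX.
  exact: (FP _ FX).2.
(* The empty set also satisfies [P], as the empty chain demands. A maximal set is not empty, since
   $\{0\}$ would be larger. *)
have A0 : A 0.
  apply: contrapT => nA0; apply: (Amax [set 0]%classic).
    split; last by move=> /(_ 0 erefl).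
    by move=> x Ax; case: nA0; rewrite -[0](addNr x) -scaleN1r; exact: AL.
  by split=> [t x y -> ->|x -> //]; rewrite scaler0 addr0.
have AZ t x : A x -> A (t *: x) by move=> Ax; rewrite -[_ *: _]addr0; exact: AL.
have BZ t x : B x -> B (t *: x) by move=> Bx; rewrite -[_ *: _]addr0; exact: BL.
have dec v : exists b, B b /\ A (v - b).
  apply: contrapT => nv.
  (* If [v] is not in $A+B$, then $A + Kv$ still meets [B] only in 0, against maximality. *)
  have nAv : ~ A v by move=> Av; apply: nv; exists 0; rewrite subr0.
  apply: (Amax [set x | exists t, A (x - t *: v)]%classic).
    split=> [x Ax|]; first by exists 0; rewrite scale0r subr0.
    by move=> /(_ v) Av; apply: nAv; apply: Av; exists 1; rewrite scale1r subrr.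
  split=> [t x y [p Ap] [q Aq]|x [t At] Bx].
    exists (t * p + q); rewrite scalerDl opprD addrACA -scalerA -scalerBr.
    exact: AL.
  have [t0|t0] := eqVneq t 0.
    by move: At; rewrite t0 scale0r subr0 => Ax; exact: AB.
  case: nv; exists (t^-1 *: x); split; first exact: BZ.
  by have := AZ (- t^-1) _ At; rewrite scalerBr scalerA mulNr mulVf // scaleN1r
    opprK addrC scaleNr.
have [r rP] := choice dec.
have [|h hr] := @lin_mapW _ _ _ r.
  move=> t x y; apply/eqP; rewrite -subr_eq0; apply/eqP/AB; last first.
    rewrite addrC -scaleN1r; apply: (BL); last exact: (rP _).1.
    by apply: BL; exact: (rP _).1.
  have := AL (-1) _ _ (rP (t *: x + y)).2 (AL t _ _ (rP x).2 (rP y).2).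
  by rewrite scaleN1r opprB scalerBr [t *: x - _ + _]addrACA -opprD addrA subrK.
exists h; split=> [x|x Bx]; rewrite hr; first exact: (rP x).1.
apply/eqP; rewrite -subr_eq0 -oppr_eq0 opprB; apply/eqP; apply: AB (rP x).2 _.
by rewrite addrC -scaleN1r; apply: BL => //; exact: (rP _).1.
Qed.

Lemma exists_linear_ginv (K : fieldType) (M N : lmodType K) (d : {linear M -> N}) :
  exists s : {linear N -> M}, forall x, d (s (d x)) = d x.
Proof.
have [||r [rK rid]] := @exists_linear_projector K M (fun x => d x = 0).
- exact: linear0.
- by move=> t x y dx dy; rewrite linearP dx dy scaler0 addr0.
have [||q [qI qid]] := @exists_linear_projector K N (fun y => exists x, d x = y).
- by exists 0; rewrite linear0.
- by move=> t _ _ [x <-] [y <-]; exists (t *: x + y); rewrite linearP.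
have [u uP] := choice qI.
(* Subtracting the projection onto the kernel makes the value independent of the chosen preimage,
   hence linear. *)
have [|h hE] := @lin_mapW _ _ _ (fun y => u y - r (u y)).
  move=> t x y; apply/eqP; rewrite -subr_eq0.
  set z := u (t *: x + y).
  have: r (z - (t *: u x + u y)) = z - (t *: u x + u y).
    by apply: rid; rewrite linearB linearP /z !uP linearP subrr.
  rewrite linearB linearP /= => e.
  rewrite scalerBr [t *: u x - _ + _]addrACA -opprD.
  set rT := _ + r _ in e *; set T := _ + u _ in e *.
  by rewrite opprB [rT - T]addrC addrACA -e [- r z + rT]addrC addrA subrK subrr.
by exists h => x; rewrite hE linearB rK subr0 uP qid //; exists x.
Qed.

(** * Contraction of a resolution onto the resolved module *)

Section Contraction.
Variables (K : fieldType) (n : nat) (g : lieAlg K n) (V : dgmod g).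

(** Keeping only the degree $-1$ component of an ungraded generalized inverse preserves its defining
    equation, as [d] is homogeneous. Boundedness makes the sum over degrees finite. *)
Lemma exists_graded_ginv : exists s : {linear V -> V},
  (forall k v, s (dg_pi V k v) = dg_pi V (k - 1) (s v)) /\
  (forall v, dg_d V (s (dg_d V v)) = dg_d V v).
Proof.
have [s0 s0P] := exists_linear_ginv (dg_d V).
have [N [_ Nsum]] := dg_bounded V.
pose j (k : 'I_(N + N).+1) : int := k%:Z - N%:Z.
have [|s sE] := @lin_mapW _ _ _
    (fun v => \sum_k dg_pi V (j k - 1) (s0 (dg_pi V (j k) v))).
  move=> t x y; rewrite scaler_sumr -big_split; apply: eq_bigr => k _ /=.
  by rewrite !linearP.
exists s; split=> [m v|v]; rewrite !sE linear_sum /=.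
  apply: eq_bigr => k _; rewrite !dg_pi_orth (inj_eq (addIr _)) [m == _]eq_sym.
  by case: eqP => [->|_]; rewrite ?linear0.
rewrite [RHS]Nsum; apply: eq_bigr => k _.
have e : dg_pi V (j k) (dg_d V v) = dg_d V (dg_pi V (j k - 1) v).
  by rewrite dg_d_pi subrK.
by rewrite dg_d_pi subrK e s0P /= -e dg_pi_orth eqxx.
Qed.

Lemma exists_contraction (E : gmod g) (alpha : E -> V) : resolution alpha ->
  exists (s : {linear V -> V}) (p : {linear V -> E}),
  [/\ forall k v, s (dg_pi V k v) = dg_pi V (k - 1) (s v),
      forall v, dg_d V (s v) + s (dg_d V v) = v - alpha (p v),
      forall e, p (alpha e) = e,
      forall v, p (dg_d V v) = 0 &
      forall k v, p (dg_pi V k v) = if k == 0 then p v else 0].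
Proof.
move=> [[V0 [aL aact ainj akerE kerE]] exV].
have [a aE] := lin_mapW aL.
have [s0 [s0pi s0P]] := exists_graded_ginv.
(* Set $s = s_0(1 - s_0 d)$. Then $sd = s_0 d$, and $1 - ds - sd$ sends [x] to $y - d s_0 y$, where
   $y = x - s_0 d x$ is closed. *)
have [|s sE] := @lin_mapW _ _ _ (fun v => s0 (v - s0 (dg_d V v))).
  by move=> t x y; rewrite !linearP /= addrACA -scalerDr linearP.
have sd v : s (dg_d V v) = s0 (dg_d V v).
  by rewrite sE dg_dd linear0 subr0.
have spi k v : s (dg_pi V k v) = dg_pi V (k - 1) (s v).
  by rewrite !sE dg_d_pi s0pi addrK -linearB s0pi.
have R v : exists e, alpha e = v - (dg_d V (s v) + s (dg_d V v)).
  have Rk k : exists e, alpha e = dg_pi V k v -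
      (dg_d V (s (dg_pi V k v)) + s (dg_d V (dg_pi V k v))).
    set x := dg_pi V k v; set y := x - s0 (dg_d V x).
    have xE : dg_pi V k x = x by rewrite /x dg_pi_orth eqxx.
    have yE : dg_pi V k y = y.
      by rewrite /y linearB /= xE -[X in dg_pi V X (s0 _)](addrK 1) -s0pi -dg_d_pi xE.
    have dy : dg_d V y = 0 by rewrite linearB /= s0P subrr.
    rewrite sd sE -/y [dg_d V (s0 y) + _]addrC opprD addrA -/y.
    (* In negative degree [y] is zero. In positive degree it is exact, so $d s_0 y = y$. In degree
       0, $s_0 y$ lies in $V^{-1} = 0$ and the closed [y] remains, which is in the image of
       [alpha]. *)
    have [k0|k0|k0] := ltgtP k 0.
    - exists 0; rewrite -aE linear0 -yE V0 //.
      by rewrite !linear0 addr0.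
    - have [u [_ du]] := exV k k0 _ yE dy.
      by exists 0; rewrite -aE linear0 -du s0P subrr.
    - have -> : s0 y = 0 by rewrite -yE s0pi k0 V0.
      by rewrite linear0 subr0; apply: kerE => //; rewrite -{1}k0.
  have [e eP] := choice Rk; have [N [_ Nsum]] := dg_bounded V.
  exists (\sum_(k < (N + N).+1) e (k%:Z - N%:Z)); rewrite -aE linear_sum /=.
  under eq_bigr do rewrite aE eP.
  by rewrite sumrB big_split /= -!linear_sum -Nsum.
(* Injectivity of [alpha] makes the chosen preimages unique, hence linear in [v]. *)
have [p0 p0E] := choice R.
have [|p pE] := @lin_mapW _ _ _ p0.
  move=> t x y; apply: ainj; rewrite aL !p0E !linearP /= scalerBr scalerDr.
  by rewrite [in LHS]addrACA opprD addrACA.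
have piE v k : alpha (p (dg_pi V k v)) = dg_pi V k (alpha (p v)).
  rewrite !pE !p0E [RHS]linearB; congr (_ - _).
  by rewrite linearD dg_d_pi !spi dg_d_pi subrK addrK.
have sa e : s (alpha e) = 0 by rewrite -(akerE e).1 spi V0.
exists s, p; split=> // [v|e|v|k v].
- by rewrite pE p0E opprB [RHS]addrC subrK.
- by apply: ainj; rewrite pE p0E (akerE e).2 sa !linear0 addr0 subr0.
- apply: ainj; rewrite pE p0E dg_dd sd linear0 addr0 s0P subrr.
  by rewrite -aE linear0.
- apply: ainj; rewrite piE -(akerE (p v)).1 dg_pi_orth.
  case: eqP => [->|_]; first by rewrite (akerE _).1.
  by rewrite -aE linear0.
Qed.
End Contraction.

(** * The perturbed contraction *)

Section Perturbation.
Variables (K : fieldType) (n : nat) (g : lieAlg K n).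
Implicit Types (V W : dgmod g) (i a : 'I_n) (m N : int).

Definition homog V W m (h : V -> W) :=
  forall k v, h (dg_pi V k v) = dg_pi W (k + m) (h v).

Lemma homog_act_comm V W m (h : {linear V -> W}) a :
  homog m h -> homog m (act_comm h a).
Proof. by move=> hh k v; rewrite /act_comm dg_act_pi !hh dg_act_pi linearB. Qed.

Fact Pdeg_is_linear V N : linear (@Pdeg K n g V N).
Proof. by move=> t u v; apply/ffunP => S; rewrite !ffunE linearP. Qed.
HB.instance Definition _ V N :=
  GRing.isLinear.Build K (Om n V) (Om n V) _ (@Pdeg K n g V N) (@Pdeg_is_linear V N).

Lemma pt_Pdeg V W m (h : {linear V -> W}) N w :
  homog m h -> pt h (Pdeg N w) = Pdeg (N + m) (pt h w).
Proof. by move=> hh; apply/ffunP => S; rewrite !ffunE hh addrAC. Qed.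

Lemma tw_Pdeg V W m (h : {linear V -> W}) N w :
  homog m h -> tw h (Pdeg N w) = Pdeg (N + m) (tw h w).
Proof. by move=> hh; apply/ffunP => S; rewrite !ffunE hh linearZ /= addrAC. Qed.

Lemma eps_Pdeg V i N (w : Om n V) : eps i (Pdeg N w) = Pdeg (N + 1) (eps i w).
Proof.
apply/ffunP => S; rewrite !ffunE; case: ifP => iS; last by rewrite linear0.
rewrite linearZ /= (cardsD1 i S) iS; congr (_ *: dg_pi V _ _).
by rewrite PoszD opprD addrA addrK.
Qed.

Variables (V W : dgmod g) (E : gmod g) (alpha : E -> V).
Variables (s : {linear V -> V}) (p : {linear V -> E}).
Hypothesis spi : homog (-1) s.
Hypothesis sp : forall v, dg_d V (s v) + s (dg_d V v) = v - alpha (p v).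
Hypothesis s_alpha : forall e, s (alpha e) = 0.
Hypothesis alpha_act : forall i e, alpha (gm_act E i e) = dg_act V i (alpha e).

Definition alpha_valued (w : Om n V) := forall S, exists e, w S = alpha e.

Definition perturb (w : Om n V) : Om n V := - \sum_a eps a (tw (act_comm s a) w).

Fact perturb_is_linear : linear perturb.
Proof.
move=> t u v; rewrite /perturb scalerN -opprD; congr (- _).
rewrite scaler_sumr -big_split; apply: eq_bigr => a _ /=.
by rewrite !linearP.
Qed.
HB.instance Definition _ :=
  GRing.isLinear.Build K (Om n V) (Om n V) _ perturb perturb_is_linear.

(** The signs of [tw] cancel in the internal part, leaving the contraction identity; the
    Chevalley-Eilenberg part is the equivariance defect of [s]. *)
Lemma dtot_tw_s w :
  dtot (tw s w) + tw s (dtot w) = w - pt (alpha \o p) w - perturb w.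
Proof.
rewrite /perturb opprK -dCE_tw /dtot !dInt_tw [tw s (_ + _)]linearD /= addrACA.
rewrite addrC; congr (_ + _); apply/ffunP => S.
rewrite !ffunE !linearZ /= !scalerA -!exprD addnn -signr_odd odd_double !scale1r.
exact: sp.
Qed.

(** Since [alpha] is equivariant and $s\alpha = 0$, the commutators $[\rho_a, s]$ vanish on the
    image of [alpha]. *)
Lemma perturb_alpha w : alpha_valued w -> perturb w = 0.
Proof.
move=> wa; rewrite /perturb big1 ?oppr0 // => a _.
rewrite (_ : tw _ _ = 0) ?linear0 //; apply/ffunP => S; rewrite !ffunE.
have [e ->] := wa S.
by rewrite /act_comm -alpha_act !s_alpha linear0 subrr scaler0.
Qed.

Lemma perturb_eps i w : perturb (eps i w) = eps i (perturb w).
Proof.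
rewrite /perturb [RHS]linearN; congr (- _); rewrite linear_sum; apply: eq_bigr => a _ /=.
by rewrite tw_eps linearN /= eps_eps opprK.
Qed.

Lemma perturb_Pdeg N w : perturb (Pdeg N w) = Pdeg N (perturb w).
Proof.
rewrite /perturb [RHS]linearN; congr (- _); rewrite linear_sum; apply: eq_bigr => a _ /=.
by rewrite (tw_Pdeg _ _ (homog_act_comm a spi)) eps_Pdeg subrK.
Qed.

Lemma perturb_filtration j (w : Om n V) :
  (forall S : {set 'I_n}, (#|S| < j)%N -> w S = 0) ->
  forall S : {set 'I_n}, (#|S| < j.+1)%N -> perturb w S = 0.
Proof.
move=> wj S Sj; rewrite /perturb ffunE sum_ffunE big1 ?oppr0 // => a _.
rewrite !ffunE; case: ifP => // aS; rewrite wj ?linear0 ?scaler0 //.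
by move: Sj; rewrite (cardsD1 a S) aS.
Qed.

(** The scalar [c] is the Koszul sign of [Th], so that one statement covers uniqueness ($c=1$,
    $m=0$) and existence ($c=-1$, $m=1$). *)
Lemma closed_map_null_homotopic (c : K) m (Th : {linear Om n V -> Om n W}) :
  (forall N w, Th (Pdeg N w) = Pdeg (N + m) (Th w)) ->
  (forall i w, Th (eps i w) = c *: eps i (Th w)) ->
  (forall w, Th (dtot w) = c *: dtot (Th w)) ->
  (forall w, alpha_valued w -> Th w = 0) ->
  exists h : {linear Om n V -> Om n W},
  [/\ forall N w, h (Pdeg N w) = Pdeg (N + m - 1) (h w),
      forall i w, h (eps i w) = - (c *: eps i (h w)),
      forall w, Th w = h (dtot w) + c *: dtot (h w) &
      forall w, alpha_valued w -> h w = 0].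
Proof.
(* No subset has more than [n] elements, so this bound holds for every [Th] and starts the
   induction. *)
have: forall w : Om n V, (forall S : {set 'I_n}, (#|S| < n.+1)%N -> w S = 0) -> Th w = 0.
  move=> w w0; rewrite (_ : w = 0) ?linear0 //; apply/ffunP => S.
  by rewrite w0 ?ffunE // ltnS -[X in (_ <= X)%N]card_ord max_card.
(* Induct on the form degree from which [Th] vanishes: composing with [perturb] lowers this bound by
   one, and at 0 the map is zero. *)
elim: (n.+1) Th => [|j IH] Th Thj Thpi The Thd Tha.
  have Th0 w : Th w = 0 by exact: Thj.
  by exists Th; split=> *; rewrite !Th0 ?linear0 ?scaler0 ?oppr0 ?addr0.
have ThN w : Th (perturb w) = Th w - Th (dtot (tw s w)) - Th (tw s (dtot w)).
  have -> : perturb w = w - pt (alpha \o p) w - (dtot (tw s w) + tw s (dtot w)).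
    by rewrite dtot_tw_s opprB addrC subrK.
  have Pw : Th (pt (alpha \o p) w) = 0.
    by apply: Tha => S; exists (p (w S)); rewrite ffunE.
  by rewrite !linearB /= Pw subr0 linearD /= opprD addrA.
have [|N w|i w|w|w wa|h [hpi he hd ha]] := IH (Th \o perturb).
- move=> w wj; apply: Thj => S Sj; exact: perturb_filtration Sj.
- by rewrite /= perturb_Pdeg Thpi.
- by rewrite /= perturb_eps The.
(* By [ThN], closedness of the composite follows from that of [Th] and from $d_{\mathrm{tot}}^2 =
   0$. *)
- rewrite /= !ThN dtot_dtot linear0 [Th 0]linear0 subr0 !Thd.
  rewrite [dtot (_ - _)]linearB /= [dtot (_ - c *: _)]linearB /= [dtot (c *: _)]linearZ /=.
  by rewrite dtot_dtot scaler0 subr0 -scalerBr.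
- by rewrite /= perturb_alpha // linear0.
(* The new summand is the term $j=0$ of the series; the homotopy for the composite supplies the
   others. *)
exists (h \+ (Th \o tw s)); split=> /= [N w|i w|w|w wa].
- by rewrite hpi (tw_Pdeg _ _ spi) Thpi linearD /= addrAC.
- by rewrite he tw_eps linearN The linearD scalerDr opprD.
- rewrite [dtot (_ + _)]linearD /= scalerDr addrACA -hd /= ThN -Thd.
  by rewrite addrA !subrK.
- rewrite ha // (_ : tw s w = 0) ?linear0 ?addr0 //; apply/ffunP => S.
  by have [e e_] := wa S; rewrite !ffunE e_ s_alpha scaler0.
Qed.

End Perturbation.

(** * Existence of the lift and its uniqueness up to homotopy *)

Theorem theorem1p8 (K : fieldType) (hK : [pchar K] =i pred0) (n : nat)
    (g : lieAlg K n) (V W : dgmod g) (E F : gmod g)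
    (alpha : E -> V) (beta : F -> W) :
  resolution alpha -> dg_lift beta ->
  forall phi : E -> F, gmod_mor phi ->
    (exists f : Om n V -> Om n W, dg_lift_mor alpha beta phi f) /\
    (forall f f' : Om n V -> Om n W,
       dg_lift_mor alpha beta phi f -> dg_lift_mor alpha beta phi f' ->
       homotopic f f').
Proof.
move=> resV [W0 [bL bact _ bker _]] phi [phiL phi_act].
have [s [p [spi sp pa pd ppi]]] := exists_contraction resV.
have [[V0 [aL aact _ aker _]] _] := resV.
have sa e : s (alpha e) = 0 by rewrite -(aker e).1 spi V0.
have null := closed_map_null_homotopic spi sp sa aact.
split.
  have [|q qE] := @lin_mapW _ _ _ (fun v => beta (phi (p v))).
    by move=> t x y; rewrite linearP phiL bL.
  have qd v : q (dg_d V v) = 0.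
    have [b bE] := lin_mapW bL; have [ph phE] := lin_mapW phiL.
    by rewrite qE pd -phE -bE !linear0.
  have dq v : dg_d W (q v) = 0 by rewrite qE (bker _).2.
  have qpi : homog 0 q.
    have [b bE] := lin_mapW bL; have [ph phE] := lin_mapW phiL.
    move=> k v; rewrite !qE ppi addr0 -(bker (phi (p v))).1 dg_pi_orth.
    case: eqP => [->|_]; first by rewrite (bker _).1.
    by rewrite -phE -bE !linear0.
  have [|Psi PsiE] := @lin_mapW _ _ _ (fun w : Om n V => dtot (pt q w) - pt q (dtot w)).
    by move=> t x y; rewrite !linearP /= addrACA -scalerDr.
  (* Since $dq = 0 = qd$, the failure of [pt q] to be a chain map comes only from the equivariance
     defect of [q]. *)
  have PsiS w : Psi w = \sum_a eps a (pt (act_comm q a) w).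
    rewrite PsiE -dCE_pt /dtot !dInt_tw linearD /= opprD addrACA.
    rewrite [X in _ + X](_ : _ = 0) ?addr0 //; apply/ffunP => S.
    by rewrite !ffunE dq linearZ /= qd !scaler0 subrr.
  have [N w|i w|w|w wa|h [hpi he hd ha]] := null W (-1) 1 Psi.
  - rewrite !PsiS linear_sum; apply: eq_bigr => a _ /=.
    by rewrite (pt_Pdeg _ _ (homog_act_comm a qpi)) addr0 eps_Pdeg.
  - rewrite !PsiS linear_sum scaleN1r -sumrN; apply: eq_bigr => a _ /=.
    by rewrite pt_eps eps_eps.
  - rewrite !PsiE dtot_dtot [pt q 0]linear0 subr0 [dtot (_ - _)]linearB /=.
    by rewrite dtot_dtot sub0r scaleN1r opprK.
  (* On the image of [alpha], [q] reduces to [beta] after [phi], which is equivariant. *)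
  - rewrite PsiS big1 // => a _; rewrite (_ : pt _ _ = 0) ?linear0 //.
    apply/ffunP => S; have [e eE] := wa S.
    by rewrite !ffunE eE /act_comm -aact !qE !pa phi_act bact subrr.
  (* The null-homotopy [h] of the odd map [Psi] has degree 0 and corrects [pt q] to a chain map. It
     vanishes on [alpha]-valued forms, so the induced map on $\mathbf H^0$ is unchanged. *)
  exists (pt q \+ h); split; last first.
    move=> e; rewrite /= ha ?addr0 => [|S]; last first.
      rewrite ffunE; case: eqP => _; [by exists e|exists 0].
      by have [a aE] := lin_mapW aL; rewrite -aE linear0.
    by rewrite !ffunE eqxx qE pa.
  split=> [t x y|N w|i w|w] /=.
  - by rewrite !linearP /= addrACA -scalerDr.
  - by rewrite (pt_Pdeg _ _ qpi) hpi addr0 addrK linearD.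
  - by rewrite pt_eps he scaleN1r opprK linearD.
  - have := hd w; rewrite PsiE scaleN1r => /eqP; rewrite subr_eq => /eqP e.
    by rewrite [dtot (_ + _)]linearD /= e [RHS]addrAC subrK addrC.
move=> f f' [[fL fpi fe fd] fa] [[f'L f'pi f'e f'd] f'a].
have [|D DE] := @lin_mapW _ _ _ (fun w => f' w - f w).
  by move=> t x y; rewrite fL f'L opprD addrACA -scalerBr.
have Dpi N w : D (Pdeg N w) = Pdeg (N + 0) (D w).
  by rewrite !DE addr0 fpi f'pi linearB.
have De i w : D (eps i w) = 1 *: eps i (D w).
  by rewrite !DE scale1r fe f'e linearB.
have [//|//|w|w wa|h [hpi he hd _]] := null W 1 0 D.
- by rewrite !DE scale1r fd f'd linearB.
(* It suffices to treat [emb0 (alpha e)], of total degree 0. The coefficients of its image on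
   nonempty sets lie in negative degrees of [W], hence vanish; on the empty set both lifts give
   [beta (phi e)]. *)
- apply: (eps_local (Q := fun v => exists e, v = alpha e)) wa.
    move=> _ [e ->]; pose u : Om n V := emb0 (alpha e); change (D u = 0).
    have uE : Pdeg 0 u = u.
      apply/ffunP => S; rewrite !ffunE; case: eqP => [->|_]; last exact: linear0.
      by rewrite cards0 subr0 (aker e).1.
    rewrite -uE Dpi addr0; apply/ffunP => S; rewrite ffunE [RHS]ffunE.
    have [->|[k kS]] := set_0Vmem S; last first.
      by apply: W0; rewrite sub0r oppr_lt0 ltz_nat; apply/card_gt0P; exists k.
    by rewrite DE sub_ffunE f'a fa subrr linear0.
  by move=> k u u0; rewrite De u0 linear0 scaler0.
exists h; split=> [t x y|N w|i w|w].
- exact: linearP.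
- by rewrite hpi addr0.
- by rewrite he scale1r.
- by rewrite -DE hd scale1r addrC.
Qed.
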